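(* Suppose that $d\le n^{C_d}$ for some absolute constant $C_d>0$ and that $\kappa s\sqrt{\log n}\,\lambda_n=o(\epsilon_n)$. Let $(X,Y)$ follow the simple $(d,s'',\mu,\Sigma)$ Gaussian classification model, and let $s'$ be the cardinality of the (constant) set $S'=S_x'$. Then, for $n$ large enough, $$\mathbb{P}(X\notin A_{n,d,\gamma})\le C_{\gamma,C_d,\mu}\,(s'+s'')\,e^{C\mu\sqrt{\gamma\log n}}\,g(2n,\gamma),$$ where $C_{\gamma,C_d,\mu}$ is some constant dependent only on $\gamma,C_d,\mu$, and $C$ is an absolute constant.
   Context: **Simple $(d,s'',\mu,\Sigma)$ Gaussian classification model.** $Z_1,\dots,Z_d$ are (jointly Gaussian) standard normal variables with invertible correlation matrix $\Sigma$; $1\le s''\le d$, $\mu>0$. $(X,Y)\in\mathbb{R}^d\times\{0,1\}$, $\mathbb{P}(Y=0)=\mathbb{P}(Y=1)=1/2$, $(X|Y=0)\overset{d}{=}(Z_1,\dots,Z_d)^T$ and $(X|Y=1)\overset{d}{=}(Z_1+\mu,\dots,Z_{s''}+\mu,Z_{s''+1},\dots,Z_d)^T$. **Notation.** $\Omega=\Sigma^{-1}$. $F_{i|y},f_{i|y}$ are the distribution function and density of $(X_i|Y=y)$; $\Phi$ is the $N(0,1)$ distribution function; $\alpha_{i|y}(t)=\Phi^{-1}(F_{i|y}(t))$, $\alpha_y(x)=(\alpha_{i|y}(x_i))_i$, $\Delta\alpha(x)=\alpha_0(x)-\alpha_1(x)$ with components $\Delta\alpha_i(x_i)$, $\Delta\log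 f_i(x_i)=\log f_{i|0}(x_i)-\log f_{i|1}(x_i)$. With $|\cdot|$ the componentwise absolute value and $[A]_{i\cdot}$ the $i$th row, $S_x'=\{i:|[\Omega-I_d]_{i\cdot}||\Delta\alpha(x)|\ne0\}$, $S_x''=\{i:\Delta\alpha_i(x_i)\ne0\}$, $S_x^f=\{i:\Delta\log f_i(x_i)\ne0\}$. Under the model $\Delta\alpha$ is constant (first $s''$ components $\mu$, others $0$), so $S_x''=\{1,\dots,s''\}$ and $S_x'=S'$ do not depend on $x$. **Rates.** $0<\gamma<2$ fixed, $a_n=\sqrt{\gamma\log n}\ge1$, $g(n,\gamma)=\frac{1}{2\sqrt{2\pi}}\frac{n^{-\gamma/2}}{\sqrt{\gamma\log n}}$ ($g(2n,\gamma)$: $n$ replaced by $2n$), $\epsilon_n=(2J_1)^{-1/2}(\gamma\log n)^{3/4}n^{-(\frac12-\frac\gamma4)}$ with $J_1=(12\pi\sqrt{2\pi})^{-1}$, $\lambda_n=\frac2{\sqrt n}\log^{1/2}(2n^{\gamma/2}d^2)$, $\bar\delta_{n,d,\gamma}=[3n^{-1}g^{-1}(2n,\gamma)\log(d\,n^{\gamma/2})]^{1/2}$, $\bar\delta_{n,1,\gamma}$ the same with $d$ replaced by $1$. $\kappa,s$ (possibly depending on $n$) are the parameters of the class $\mathcal U(s,M,\kappa)$ of matrices $\Omega\succ0$ with $\mathrm{diag}(\Omega^{-1})=\mathbf 1$, $\lambda_{\max}(\Omega)\le\kappa$, at most $s$ nonzeros per column, and maximum absolute row sum $\le M$. $d,s',s''$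 may vary with $n$. **Kernel, bandwidth, density level.** The densities are Gaussian (super-smooth), and for every $i$: kernel $K_i=K^{(\lceil\log n\rceil)}$, where $K^{(l)}(u)=\sum_{m=0}^l\varphi_m(0)\varphi_m(u)\mathbf 1\{|u|\le1\}$ with $\varphi_m$ the orthonormal Legendre polynomials on $[-1,1]$; bandwidth $h_{n,i}=H_i(\log n)^{-1/2}$ with a constant $0<H_i\le\log(2)/\sqrt\gamma$; and $\underline{f_{n,i}}=J_{\gamma,C_d}H_i^{-1}\log(n)\,n^{-\gamma/2}$. Here $J_{\gamma,C_d}$ is a finite constant depending only on $\gamma,C_d$, large enough that for $n$ large enough, with $\widehat f_{i|y}(t)=\frac1{nh_{n,i}}\sum_{j=1}^nK_i((X_i^{y,j}-t)/h_{n,i})$ for $n$ i.i.d. copies $X^{y,j}$ of $(X|Y=y)$, $\mathbb{P}\{|\widehat f_{i|y}(t)-f_{i|y}(t)|/f_{i|y}(t)\ge\epsilon_n\}\le\frac1dn^{-\gamma/2}$ whenever $t\in B^f_{h_{n,i},i,y}$ (defined below) and $f_{i|y}(t)\ge\underline{f_{n,i}}$. **Sets.** $B_{n,\gamma,i,y}=\{t:8g(2n,\gamma)\le F_{i|y}(t)\le1-8g(2n,\gamma)\}$. $B^\delta_{n,d,\gamma,i}$ is the set of $t$ for which at least one of $\frac{F_{i|0}(t)}{F_{i|1}(t)},\frac{F_{i|1}(t)}{F_{i|0}(t)},\frac{1-F_{i|0}(t)}{1-F_{i|1}(t)},\frac{1-F_{i|1}(t)}{1-F_{i|0}(t)}$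 is $>\frac{(1+\bar\delta_{n,d,\gamma})(1+\bar\delta_{n,1,\gamma})}{(1-\bar\delta_{n,d,\gamma})(1-\bar\delta_{n,1,\gamma})}$. $A^F_{n,d,\gamma}=\{x:\forall i\in S_x'',\ x_i\in B_{n,\gamma,i,0}\cap B_{n,\gamma,i,1}\cap B^\delta_{n,d,\gamma,i}\}$. $A^F_{n,\beta^*,\gamma}=\{x:\forall i\in S_x',\forall y,\ \alpha_{i|y}(x_i)\in[-a_n,a_n]\}$. $B^f_{h_{n,i},i,y}$ is the set of $t$ such that: if $f_{i|y}(t)<\underline{f_{n,i}}$ then $\max_{t'\in[t-h_{n,i},t+h_{n,i}]}f_{i|y}(t')\le2\underline{f_{n,i}}$; and if $f_{i|y}(t)\ge\underline{f_{n,i}}$ then $\max_{t'\in[t-h_{n,i},t+h_{n,i}]}f_{i|y}(t')\le2f_{i|y}(t)$. $A^f_{n,i}=\{t:f_{i|y}(t)\ge\frac3{1-\epsilon_n}\underline{f_{n,i}}\ \forall y\}$. $A^{f,=}_{n,d,\gamma}=\{x:\forall i\notin S_x^f,\ x_i\in\cap_yB^f_{h_{n,i},i,y}\}$, $A^{f,\ne}_{n,d,\gamma}=\{x:\forall i\in S_x^f,\ x_i\in A^f_{n,i}\cap(\cap_yB^f_{h_{n,i},i,y})\}$. $A_{n,d,\gamma}=A^F_{n,d,\gamma}\cap A^F_{n,\beta^*,\gamma}\cap A^{f,=}_{n,d,\gamma}\cap A^{f,\ne}_{n,d,\gamma}$. ''n large enough'' means $n\ge n_0$ for some $n_0$.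
   Formalization: The bandwidth constants H_i are assumed bounded below by one positive constant uniformly in i and n; if H_i may tend to 0 rapidly while d grows, the density level can exceed the maximal density and the claimed bound fails. *)

(* Defs.v *)
From HB Require Import structures.
From mathcomp Require Import all_boot all_order all_algebra.
From mathcomp Require Import all_classical all_reals all_analysis.

Set Implicit Arguments.
Unset Strict Implicit.
Unset Printing Implicit Defensive.

Import Order.TTheory GRing.Theory Num.Theory.
Import numFieldNormedType.Exports.

Local Open Scope classical_set_scope.
Local Open Scope ring_scope.

(* Labels Y = 0 and Y = 1 are the booleans false and true; coordinates are
   numbered from 0, so "the first s'' coordinates" are the i with i < s''. *)

Section Rates.
Context {R : realType}.
Implicit Types (gam J H : R) (n d : nat).

Definition a_ gam n : R := Num.sqrt (gam * ln n%:R).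

Definition g_ gam n : R :=
  (2 * Num.sqrt (2 * pi))^-1 *
  (n%:R `^ (- (gam / 2)) / Num.sqrt (gam * ln n%:R)).

Definition J1 : R := (12 * pi * Num.sqrt (2 * pi))^-1.

Definition eps_ gam n : R :=
  (2 * J1) `^ (- (1 / 2)) * (gam * ln n%:R) `^ (3 / 4)
  * n%:R `^ (- (1 / 2 - gam / 4)).

Definition lambda_ gam n d : R :=
  2 / Num.sqrt n%:R * Num.sqrt (ln (2 * n%:R `^ (gam / 2) * d%:R ^+ 2)).

Definition bar_delta gam n d : R :=
  Num.sqrt (3 * n%:R^-1 * (g_ gam (2 * n))^-1 *
            ln (d%:R * n%:R `^ (gam / 2))).

Definition bandwidth H n : R := H / Num.sqrt (ln n%:R).

Definition density_level gam J H n : R :=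
  J * H^-1 * ln n%:R * n%:R `^ (- (gam / 2)).

End Rates.

Section LegendreKernel.
Context {R : realType}.

(* Rodrigues' formula, normalised in L^2([-1, 1]). *)
Definition legendre (m : nat) : {poly R} :=
  (Num.sqrt ((2 * m + 1)%:R / 2) / (2 ^ m * m`!)%:R) *:
  (('X ^+ 2 - 1) ^+ m)^`(m).

Definition legendre_kernel (l : nat) (u : R) : R :=
  \sum_(m < l.+1) (legendre m).[0] * (legendre m).[u] * (`|u| <= 1)%R%:R.

Definition kernel_order (n : nat) : nat := absz (Num.ceil (ln n%:R : R)).

End LegendreKernel.

Section StandardNormal.
Context {R : realType}.

Definition Phi (t : R) : R := fine (normal_prob (0 : R) 1 `]-oo, t]).

Definition Phi_inv : R -> R := 'pinv_(fun=> 0) [set: R] Phi.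

(* normal_prob m 0 is not a point mass in the library. *)
Definition normal_law (m s : R) (A : set R) : \bar R :=
  if s == 0 then \d_m A else normal_prob m s A.

End StandardNormal.

Section MatrixClass.
Context {R : realType} {d : nat}.

Definition posdef (A : 'M[R]_d) : Prop :=
  A^T = A /\ forall v : 'rV[R]_d, v != 0 -> 0 < (v *m A *m v^T) 0 0.

Definition class_U (s : nat) (M kappa : R) (Om : 'M[R]_d) : Prop :=
  [/\ posdef Om,
      (forall i, invmx Om i i = 1),
      (forall a, eigenvalue Om a -> a <= kappa),
      (forall j, (#|finset (fun i => Om i j != 0%R)| <= s)%N) &
      (forall i, \sum_j `|Om i j| <= M)].

End MatrixClass.

Definition cond_prob {disp} {T : measurableType disp} {R : realType}
    (P : probability T R) (A B : set T) : R :=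
  fine (P (A `&` B)) / fine (P B).

(* Z_1, ..., Z_d are jointly Gaussian, each N(0,1), with invertible correlation
   matrix Sig; since the variances are 1, correlations are covariances. *)
Definition standard_gaussian {R : realType} {d : nat} {disp}
    {T : measurableType disp} (P : probability T R)
    (Z : {RV P >-> d.-tuple R}) (Sig : 'M[R]_d) : Prop :=
  [/\ (forall a : 'I_d -> R, exists m s : R, 0 <= s /\
         forall A : set R, measurable A ->
           P [set w | A (\sum_i a i * tnth (Z w) i)] = normal_law m s A),
      (forall i (A : set R), measurable A ->
           P [set w | A (tnth (Z w) i)] = normal_prob (0 : R) 1 A),
      (forall i j, covariance P (fun w => tnth (Z w) i)
                     (fun w => tnth (Z w) j) = (Sig i j)%:E) &
      Sig \in unitmx].

Definition class_shift {R : realType} {d : nat} (s'' : nat) (mu : R) (y : bool)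
    (z : d.-tuple R) : d.-tuple R :=
  [tuple tnth z i + (if y && (i < s'')%N then mu else 0) | i < d].

Definition gaussian_model {R : realType} {d : nat} {disp}
    {T : measurableType disp} (P : probability T R)
    (X : {RV P >-> d.-tuple R}) (Y : {RV P >-> bool})
    (s'' : nat) (mu : R) (Sig : 'M[R]_d) : Prop :=
  [/\ (1 <= s'' <= d)%N, 0 < mu,
      (forall y, P [set w | Y w = y] = (1 / 2)%:E) &
      exists dispZ (TZ : measurableType dispZ) (PZ : probability TZ R)
        (Z : {RV PZ >-> d.-tuple R}),
        standard_gaussian Z Sig /\
        forall y (A : set (d.-tuple R)), measurable A ->
          cond_prob P [set w | A (X w)] [set w | Y w = y] =
          fine (PZ [set w | A (class_shift s'' mu y (Z w))])].

Section ModelSets.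
Context {R : realType} {d : nat} {disp} {T : measurableType disp}
  {P : probability T R}.
Variables (X : {RV P >-> d.-tuple R}) (Y : {RV P >-> bool}).
Implicit Types (i : 'I_d) (y : bool) (t : R) (x : d.-tuple R).

Definition cond_cdf i y t : R :=
  cond_prob P [set w | tnth (X w) i <= t] [set w | Y w = y].

(* The version of the density that is the derivative of the distribution
   function: the sets below use its values at points. *)
Definition cond_pdf i y : R -> R := derive1 (cond_cdf i y).

Definition alpha i y t : R := Phi_inv (cond_cdf i y t).

Definition dalpha i t : R := alpha i false t - alpha i true t.

Definition dlogf i t : R := ln (cond_pdf i false t) - ln (cond_pdf i true t).

(* S1, S2 and Sf are the sets written S', S'' and S^f with index x. *)
Definition S1 (Sig : 'M[R]_d) x : {set 'I_d} :=
  finset (fun i =>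
    \sum_j `|(invmx Sig - 1%:M) i j| * `|dalpha j (tnth x j)| != 0).

Definition S2 x : {set 'I_d} := finset (fun i => dalpha i (tnth x i) != 0).

Definition Sf x : {set 'I_d} := finset (fun i => dlogf i (tnth x i) != 0).

Section Sets.
Variables (gam J : R) (n : nat) (Sig : 'M[R]_d) (H : 'I_d -> R).

Let h i := bandwidth (H i) n.
Let flow i := density_level gam J (H i) n.

Definition B_ i y : set R :=
  [set t | 8 * g_ gam (2 * n) <= cond_cdf i y t <= 1 - 8 * g_ gam (2 * n)].

Definition ratio_threshold : R :=
  (1 + bar_delta gam n d) * (1 + bar_delta gam n 1) /
  ((1 - bar_delta gam n d) * (1 - bar_delta gam n 1)).

Definition Bdelta i : set R :=
  [set t | exists y,
     ratio_threshold < cond_cdf i y t / cond_cdf i (~~ y) t \/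
     ratio_threshold < (1 - cond_cdf i y t) / (1 - cond_cdf i (~~ y) t)].

Definition AF : set (d.-tuple R) :=
  [set x | forall i, i \in S2 x ->
     (B_ i false `&` B_ i true `&` Bdelta i) (tnth x i)].

Definition AFbeta : set (d.-tuple R) :=
  [set x | forall i, i \in S1 Sig x -> forall y,
     - a_ gam n <= alpha i y (tnth x i) <= a_ gam n].

Definition max_pdf i y t : R :=
  sup [set cond_pdf i y t' | t' in `[t - h i, t + h i]].

Definition Bf i y : set R :=
  [set t | (cond_pdf i y t < flow i -> max_pdf i y t <= 2 * flow i) /\
           (flow i <= cond_pdf i y t -> max_pdf i y t <= 2 * cond_pdf i y t)].

Definition Af_coord i : set R :=
  [set t | forall y, 3 / (1 - eps_ gam n) * flow i <= cond_pdf i y t].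

Definition Af_eq : set (d.-tuple R) :=
  [set x | forall i, i \notin Sf x -> forall y, Bf i y (tnth x i)].

Definition Af_neq : set (d.-tuple R) :=
  [set x | forall i, i \in Sf x ->
     Af_coord i (tnth x i) /\ forall y, Bf i y (tnth x i)].

Definition A_ : set (d.-tuple R) := AF `&` AFbeta `&` Af_eq `&` Af_neq.

(* W_0, ..., W_(n-1) are independent copies of (X | Y = y); taking some A_j to be
   the whole space gives the product rule for every subfamily. *)
Definition iid_copies {dispW} {TW : measurableType dispW}
    (PW : probability TW R) (y : bool)
    (W : 'I_n -> {RV PW >-> d.-tuple R}) : Prop :=
  (forall j (A : set (d.-tuple R)), measurable A ->
     fine (PW [set w | A (W j w)]) =
     cond_prob P [set w | A (X w)] [set w | Y w = y]) /\
  (forall A : 'I_n -> set (d.-tuple R), (forall j, measurable (A j)) ->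
     fine (PW [set w | forall j, A j (W j w)]) =
     \prod_j fine (PW [set w | A j (W j w)])).

Definition kde (W : 'I_n -> d.-tuple R) i t : R :=
  (n%:R * h i)^-1 *
  \sum_j legendre_kernel (@kernel_order R n) ((tnth (W j) i - t) / h i).

(* The deviation bound for the density estimator that fixes how large the
   constant J of density_level must be. *)
Definition kde_deviation : Prop :=
  forall i y t, Bf i y t -> flow i <= cond_pdf i y t ->
  forall dispW (TW : measurableType dispW) (PW : probability TW R)
    (W : 'I_n -> {RV PW >-> d.-tuple R}), iid_copies y W ->
  (PW [set w | (eps_ gam n <=
         `|kde (fun j => W j w) i t - cond_pdf i y t| / cond_pdf i y t)%R]
   <= (d%:R^-1 * n%:R `^ (- (gam / 2)))%:E)%E.

End Sets.
End ModelSets.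

(* Main.v *)
Require Import Defs.
From HB Require Import structures.
From mathcomp Require Import all_boot all_order all_algebra.
From mathcomp Require Import all_classical all_reals all_analysis.
From mathcomp Require Import measurable_realfun ring lra.

Set Implicit Arguments.
Unset Strict Implicit.
Unset Printing Implicit Defensive.

Import Order.TTheory GRing.Theory Num.Theory.
Import numFieldNormedType.Exports.

Local Open Scope classical_set_scope.
Local Open Scope ring_scope.

(** Under the model every marginal is a unit-variance Gaussian whose mean is 0,
or mu for the shifted coordinates of class 1 ([mean_shift]).  So F_{i|y}(t) is
Phi(t - shift), f_{i|y}(t) is phi(t - shift), alpha_{i|y}(t) is t - shift, and
every condition that defines A_ bears on single coordinates of x.

For n large two of these conditions exclude nothing.  That is needed: B^f bears
on all d coordinates, more than a bound in s' + s'' can pay for, and a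
failure of B^delta would not be confined to the tails of X_i:
- the regularity condition B^f holds at every point ([Bf_setT]), because
  h a_n <= ln 2 makes phi at most double over a window of half-width h
  centred in [-a_n, a_n], while outside of [-a_n, a_n] phi is below the density
  level ([near_pdf_le_level]);
- the separation condition B^delta holds at every point of a shifted
  coordinate ([Bdelta_setT]), because one of the ratios
  Phi(t) / Phi(t - mu) and (1 - Phi(t - mu)) / (1 - Phi(t)) exceeds a constant
  larger than 1 that depends on mu only ([Phi_shift_separation]), whereas the
  threshold tends to 1 ([near_ratio_threshold_lt]).

The remaining conditions concern the coordinates of S' and the first s'' ones,
and all of them hold as soon as |x_i| <= a_n - 2 mu ([good_small]): then
|x_i - shift| <= a_n - mu for both labels, so the tail Phi(-|x_i - shift|) is at
least mu phi(a_n), which exceeds 8 g(2n), and the density phi(x_i - shift) is at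
least phi(a_n - mu), of order n^{-gamma/2} e^{mu a_n}, which exceeds
3 / (1 - epsilon_n) times the level, of order log(n) n^{-gamma/2}.  The event
|X_i| > a_n - 2 mu has probability at most
2 Phi(3 mu - a_n) <= 2 phi(a_n - 3 mu) ([coord_tail], [Phi_le_normal_pdf]), of
order n^{-gamma/2} e^{3 mu a_n}.  A union bound over at most s' + s''
coordinates ([prob_not_A]) concludes with C = 4: a fourth factor e^{mu a_n}
absorbs the 1 / a_n in g(2n) and all the constants, so that K = 1 is enough
([near_tail_le_g]). *)

(** * The standard normal distribution *)

Section GaussianTail.
Context {R : realType}.
Implicit Types s t u b c : R.

Local Notation phi := (normal_pdf (0 : R) 1).

Lemma normal_pdf01E t :
  normal_pdf (0 : R) 1 t = (Num.sqrt (2 * pi))^-1 * expR (- (t ^+ 2 / 2)).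
Proof.
rewrite normal_pdfE ?oner_neq0// /normal_peak /normal_fun subr0 expr1n mul1r.
by rewrite mulr_natl mulNr.
Qed.

Lemma sqrt2pi_gt0 : 0 < Num.sqrt (2 * pi) :> R.
Proof. by rewrite sqrtr_gt0 mulr_gt0 ?pi_gt0. Qed.

Lemma normal_pdf01_gt0 t : 0 < phi t.
Proof. by rewrite normal_pdf01E mulr_gt0 ?expR_gt0// invr_gt0 sqrt2pi_gt0. Qed.

Lemma normal_pdf01_opp t : phi (- t) = phi t.
Proof. by rewrite !normal_pdf01E sqrrN. Qed.

Lemma le_normal_pdf01 s t : s ^+ 2 <= t ^+ 2 -> phi t <= phi s.
Proof.
move=> st; rewrite !normal_pdf01E ler_pM2l ?invr_gt0 ?sqrt2pi_gt0//.
by rewrite ler_expR lerN2 ler_pM2r ?invr_gt0.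
Qed.

Lemma normal_pdf01_le_norm s t : phi t <= phi s -> `|s| <= `|t|.
Proof.
move=> st; rewrite leNgt; apply/negP => ts; move: st; apply/negP.
rewrite -ltNge !normal_pdf01E ltr_pM2l ?invr_gt0 ?sqrt2pi_gt0//.
rewrite ltr_expR ltrN2 ltr_pM2r ?invr_gt0//.
by rewrite -(real_normK (num_real s)) -(real_normK (num_real t)) ltr_pXn2r ?nnegrE.
Qed.

Lemma is_derive_Phi t : is_derive t 1 (@Phi R) (phi t).
Proof.
have [] := @continuous_FTC1 R phi -oo%O t (t + 1).
- by rewrite ltrDl.
- by apply: (integrableS _ _ (subsetT _)) => //; exact: integrable_normal_pdf.
- by rewrite ltNyr.
- by apply: continuous_normal_pdf; rewrite oner_neq0.
- move=> dF F'; apply: DeriveDef; first exact: dF.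
  by rewrite -derive1E.
Qed.

Lemma is_derive_normal_pdf t : is_derive t 1 phi (- t * phi t).
Proof.
pose f s : R := (Num.sqrt (2 * pi))^-1 * expR (- (s ^+ 2 / 2)).
have -> : phi = f by apply/funext => s; exact: normal_pdf01E.
apply: is_derive_eq; rewrite /f !scaler1 !scaler0 !add0r.
by rewrite /GRing.scale /=; set e := expR _; field; rewrite gt_eqF ?sqrt2pi_gt0.
Qed.

Lemma Phi_ge0 t : 0 <= Phi t.
Proof. by rewrite fine_ge0. Qed.

Lemma Phi_le1 t : Phi t <= 1.
Proof.
rewrite /Phi -[leRHS]/(fine 1%E) fine_le ?fin_num_measure//.
exact: probability_le1.
Qed.

Lemma Phi_cvg :
  (@Phi R t) @[t --> -oo] --> (0 : R) /\ (@Phi R t) @[t --> +oo] --> (1 : R).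
Proof.
(* Phi is the distribution function of the identity under normal_prob. *)
pose id1 : measurableTypeR R -> R := idfun.
have mid : measurable_fun setT id1 by exact: measurable_id.
pose m := isMeasurableFun.Build _ _ _ _ id1 mid.
pose X : {RV normal_prob (0 : R) 1 >-> R} := HB.pack id1 m.
split; apply/fine_cvg; [have := cvg_cdfNy0 X|have := cvg_cdfy1 X];
  by apply: cvg_trans; apply: near_eq_cvg; near=> t.
Unshelve. all: by end_near. Qed.

Lemma derive1_continuous_within (f df : R -> R) (A : set R) :
  (forall t, is_derive t 1 f (df t)) -> {within A, continuous f}.
Proof.
move=> fdf; apply/continuous_subspaceT => r.
exact/differentiable_continuous/derivable1_diffP.
Qed.

Lemma Phi_sub s t : s <= t ->
  exists2 c, s <= c <= t & Phi t - Phi s = phi c * (t - s).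
Proof.
move=> st; have [|c cst e] := MVT_segment st (fun x _ => is_derive_Phi x).
  exact: derive1_continuous_within is_derive_Phi.
by exists c => //; rewrite in_itv in cst.
Qed.

Lemma Phi_lt s t : s < t -> Phi s < Phi t.
Proof.
move=> st; have [c _ e] := Phi_sub (ltW st).
by rewrite -subr_gt0 e mulr_gt0 ?normal_pdf01_gt0// subr_gt0.
Qed.

Lemma Phi_mono : {mono @Phi R : s t / s <= t}.
Proof. by apply: le_mono => s t; exact: Phi_lt. Qed.

Lemma Phi_gt0 t : 0 < Phi t.
Proof. by rewrite (le_lt_trans (Phi_ge0 (t - 1)))// Phi_lt// gtrBl. Qed.

Lemma Phi_lt1 t : Phi t < 1.
Proof. by rewrite (lt_le_trans (@Phi_lt t (t + 1) _)) ?Phi_le1// ltrDl. Qed.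

Lemma Phi_invK : cancel (@Phi R) Phi_inv.
Proof.
move=> t; rewrite /Phi_inv pinvKV ?inE// => s u _ _; exact: (inc_inj Phi_mono).
Qed.

(** Phi(t) + Phi(-t) has derivative 0, and tends to 1 at infinity. *)
Lemma Phi_opp t : Phi (- t) = 1 - Phi t.
Proof.
pose f (s : R) : R := Phi s + (Phi \o -%R) s.
have df s : is_derive s 1 f 0.
  rewrite /f; have h1 := is_derive_Phi s; have h2 := is_derive_Phi (- s).
  by apply: is_derive_eq; rewrite normal_pdf01_opp mulrN1 subrr.
have fcst s : f s = f t by exact: is_derive_0_is_cst.
suff ft1 : f t = 1 by rewrite -ft1 /f /= addrAC subrr add0r.
have f1 : f s @[s --> +oo] --> (1 + 0 : R).
  by apply: cvgD; [exact: Phi_cvg.2|exact: ((cvgNy_compNP _ _).1 Phi_cvg.1)].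
have ft : f s @[s --> +oo] --> f t.
  by under eq_fun do rewrite fcst; exact: cvg_cst.
by rewrite (cvg_unique _ ft f1)// addr0.
Qed.

(** Gaussian tails are compared through derivatives: a function that increases
on ]-oo, b] and is not below a multiple of - Phi cannot start below 0 at -oo,
since Phi vanishes there. *)
Lemma ge0_of_increasing_Ny (f df : R -> R) b c :
  (forall t, is_derive t 1 f (df t)) -> (forall t, t <= b -> 0 <= df t) ->
  (forall t, - c * Phi t <= f t) ->
  forall t, t <= b -> 0 <= f t.
Proof.
move=> fdf df0 fge t tb.
have h : (- c * Phi s) @[s --> -oo] --> (- c * 0 : R).
  by apply: cvgM; [exact: cvg_cst|exact: Phi_cvg.1].
rewrite mulr0 in h; apply: (cvgr_to_le h).
near=> s; rewrite (le_trans (fge s))//.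
have st : s <= t by near: s; apply: nbhs_ninfty_le; rewrite num_real.
apply: (@ger0_derive1_ndecrNy _ f b) => // [u ub|].
- rewrite derive1E derive_val; apply: df0; rewrite in_itv in ub.
  exact: ltW.
- exact: derive1_continuous_within fdf.
Unshelve. all: by end_near. Qed.

(** On t <= -1 the derivative - t phi(t) of phi is at least that of Phi. *)
Lemma Phi_le_normal_pdf t : t <= -1 -> Phi t <= phi t.
Proof.
move=> t1; rewrite -subr_ge0.
apply: (@ge0_of_increasing_Ny (fun s => phi s - Phi s)
  (fun s => - s * phi s - phi s) (-1) 1) t1 => [s|s s1|s].
- by apply: is_deriveB; [exact: is_derive_normal_pdf|exact: is_derive_Phi].
- rewrite -[X in _ - X]mul1r -mulrBl mulr_ge0 ?(ltW (normal_pdf01_gt0 _))//.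
  lra.
- by rewrite mulN1r lerDr ltW// normal_pdf01_gt0.
Qed.

(** The likelihood ratio phi(s) / phi(s - mu) = e^{mu^2/2 - mu s} is at least
e^{mu^2/2} on s <= 0, and integrating over ]-oo, t] keeps this bound. *)
Lemma Phi_shift_ratio mu t : 0 <= mu -> t <= 0 ->
  expR (mu ^+ 2 / 2) * Phi (t - mu) <= Phi t.
Proof.
move=> mu0 t0; rewrite -subr_ge0; set k := expR _.
have dsh s : is_derive s 1 ((@Phi R) \o (fun x => x - mu)) (phi (s - mu)).
  have h := is_derive_Phi (s - mu); apply: is_derive_eq.
  by rewrite subr0 mulr1.
apply: (@ge0_of_increasing_Ny (fun s => Phi s - k * Phi (s - mu))
  (fun s => phi s - k * phi (s - mu)) 0 k) t0 => [s|s s0|s].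
- have dk : is_derive s 1 (fun x => k * Phi (x - mu)) (k * phi (s - mu)).
    exact: (@is_deriveZ _ _ _ _ _ _ _ _ (dsh s)).
  exact: (is_deriveB (is_derive_Phi s) dk).
- rewrite subr_ge0 !normal_pdf01E mulrCA ler_pM2l ?invr_gt0 ?sqrt2pi_gt0//.
  rewrite /k -expRD ler_expR -subr_ge0.
  have -> : - (s ^+ 2 / 2) - (mu ^+ 2 / 2 - (s - mu) ^+ 2 / 2) = - s * mu.
    by field.
  by rewrite mulr_ge0// oppr_ge0.
- rewrite mulNr lerBrDl -mulrBr (le_trans _ (Phi_ge0 s))//.
  by rewrite pmulr_rle0 ?expR_gt0// subr_le0 Phi_mono gerBl.
Qed.

(** Phi(-b) contains the mass of the interval [-b - mu, -b], on which phi is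
smallest at the far end; the width mu costs only a factor e^{- mu b}. *)
Lemma Phi_lower mu b : 0 <= mu -> 0 <= b -> mu * phi (b + mu) <= Phi (- b).
Proof.
move=> mu0 b0.
have [|c /andP[c1 c2] e] := @Phi_sub (- b - mu) (- b); first by rewrite gerBl.
rewrite -[leRHS](subrK (Phi (- b - mu))) e -[leLHS]addr0 lerD ?Phi_ge0//.
rewrite opprB addrCA subrr addr0 mulrC ler_wpM2r// le_normal_pdf01//.
nra.
Qed.

End GaussianTail.

(** * Class-conditional distributions of the coordinates *)

Section ClassConditionals.
Context {R : realType} {d : nat} {disp} {T : measurableType disp}
  {P : probability T R}.
Variables (X : {RV P >-> d.-tuple R}) (Y : {RV P >-> bool}).
Variables (s'' : nat) (mu : R) (Sig : 'M[R]_d).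
Hypothesis model : gaussian_model X Y s'' mu Sig.
Implicit Types (i : 'I_d) (y : bool) (t : R).

Local Notation phi := (normal_pdf (0 : R) 1).

Definition mean_shift i y : R := if y && (i < s'')%N then mu else 0.

Lemma mu_gt0 : 0 < mu.
Proof. by have [] := model. Qed.

Lemma mean_shift_itv i y : 0 <= mean_shift i y <= mu.
Proof.
by rewrite /mean_shift; case: ifP => _; rewrite lexx (ltW mu_gt0).
Qed.

Lemma measurable_coord i (E : set R) : measurable E ->
  measurable [set x : d.-tuple R | E (tnth x i)].
Proof.
by move=> mE; rewrite -[X in measurable X]setTI; apply: measurable_tnth.
Qed.

(** The joint law of Z plays a part in the model only through its marginals once
an event concerns a single coordinate. *)
Lemma cond_prob_coord i y (E : set R) : measurable E ->
  cond_prob P [set w | E (tnth (X w) i)] [set w | Y w = y] =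
  fine (normal_prob (0 : R) 1 [set t | E (t + mean_shift i y)]).
Proof.
move=> mE; have [_ _ _ [dZ [TZ [PZ [Z [[_ Zstd _ _] XZ]]]]]] := model.
rewrite (XZ y [set x | E (tnth x i)]); last exact: measurable_coord.
have mf : measurable_fun setT (fun t : R => t + mean_shift i y).
  exact: measurable_funD.
rewrite -(Zstd i); last by have := mf measurableT _ mE; rewrite setTI.
congr (fine (PZ _)); apply/seteqP.
by split=> w /=; rewrite /class_shift tnth_mktuple.
Qed.

Lemma cond_cdfE i y t : cond_cdf X Y i y t = Phi (t - mean_shift i y).
Proof.
rewrite /cond_cdf -[LHS]/(cond_prob P [set w | [set u | u <= t] (tnth (X w) i)]
   [set w | Y w = y]) cond_prob_coord.
  rewrite /Phi; congr (fine (normal_prob _ _ _)).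
  by apply/seteqP; split=> u /=; rewrite in_itv/= lerBrDr.
rewrite (_ : [set u | u <= t] = `]-oo, t]%classic); first exact: measurable_itv.
by apply/seteqP; split=> u /=; rewrite in_itv.
Qed.

Lemma cond_pdfE i y t : cond_pdf X Y i y t = phi (t - mean_shift i y).
Proof.
rewrite /cond_pdf (_ : cond_cdf X Y i y = @Phi R \o (fun u => u - mean_shift i y)).
  have h := is_derive_Phi (t - mean_shift i y).
  by rewrite derive1E derive_val subr0 mulr1.
by apply/funext => u; exact: cond_cdfE.
Qed.

Lemma alphaE i y t : alpha X Y i y t = t - mean_shift i y.
Proof. by rewrite /alpha cond_cdfE Phi_invK. Qed.

Lemma dalphaE i t : dalpha X Y i t = if (i < s'')%N then mu else 0.
Proof. by rewrite /dalpha !alphaE /mean_shift /=; case: ifP => _; ring. Qed.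

Lemma in_S2 x i : (i \in S2 X Y x) = (i < s'')%N.
Proof.
by rewrite /S2 finset.inE dalphaE; case: ifP => _; rewrite ?eqxx// gt_eqF ?mu_gt0.
Qed.

(** Delta alpha is constant. *)
Lemma S1_cst x x' : S1 X Y Sig x = S1 X Y Sig x'.
Proof.
apply/setP => i; rewrite /S1 !finset.inE.
by under eq_bigr do rewrite dalphaE; under [in RHS]eq_bigr do rewrite dalphaE.
Qed.

Lemma dlogf0 i t : (s'' <= i)%N -> dlogf X Y i t = 0.
Proof.
move=> si; rewrite /dlogf !cond_pdfE /mean_shift /= ltnNge si subrr //.
Qed.

Lemma measurable_cond_pdf i y : measurable_fun setT (cond_pdf X Y i y).
Proof.
rewrite (_ : cond_pdf X Y i y = phi \o (fun t => t - mean_shift i y)).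
  by apply: measurableT_comp; [exact: measurable_normal_pdf|exact: measurable_funB].
by apply/funext => t; exact: cond_pdfE.
Qed.

Lemma measurable_cond_cdf i y : measurable_fun setT (cond_cdf X Y i y).
Proof.
apply: nondecreasing_measurable => // s t st.
by rewrite !cond_cdfE Phi_mono lerD2r.
Qed.

Lemma measurable_alpha i y : measurable_fun setT (alpha X Y i y).
Proof.
rewrite (_ : alpha X Y i y = fun t => t - mean_shift i y).
  exact: measurable_funB.
by apply/funext => t; exact: alphaE.
Qed.

Lemma measurable_dlogf i : measurable_fun setT (dlogf X Y i).
Proof.
apply: measurable_funB; apply: measurableT_comp => //; exact: measurable_cond_pdf.
Qed.

Lemma measurable_abs_gt b : measurable [set t : R | b < `|t|].
Proof.
rewrite (_ : [set t | _] = Num.norm @^-1` `]b, +oo[).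
  by rewrite -[X in measurable X]setTI; apply: normr_measurable.
by apply/seteqP; split=> t /=; rewrite in_itv/= andbT.
Qed.

Lemma normal_prob_tail (c : R) :
  (normal_prob (0 : R) 1 [set t | (c < `|t|)%R] <= (2 * Phi (- c))%:E)%E.
Proof.
apply: (@le_trans _ _ (normal_prob (0 : R) 1 (`]-oo, (- c)] `|` ~` `]-oo, c]))).
  apply: le_measure; rewrite ?inE.
  - exact: measurable_abs_gt.
  - by apply: measurableU; [|apply: measurableC]; exact: measurable_itv.
  - move=> t /=; rewrite lter_normr => /orP[ct|ct].
      by right; rewrite /= in_itv/=; apply/negP; rewrite -ltNge.
    by left; rewrite /= in_itv/= lerNr ltW.
apply: (le_trans (measureU2 _ _ _)); [exact: measurable_itv| |].
  by apply: measurableC; exact: measurable_itv.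
rewrite [X in (_ + X <= _)%E]probability_setC; last exact: measurable_itv.
have PhiE t : normal_prob (0 : R) 1 `]-oo, t] = (Phi t)%:E.
  by rewrite /Phi fineK// fin_num_measure.
apply: (@le_trans _ _ ((Phi (- c))%:E + (1 - (Phi c)%:E))%E).
  by rewrite -!PhiE.
by rewrite -EFinB -EFinD lee_fin -Phi_opp; lra.
Qed.

(** Given either label, X_i is a standard normal variable moved by at most mu. *)
Lemma coord_tail i b :
  (P [set w | (b < `|tnth (X w) i|)%R] <= (2 * Phi (mu - b))%:E)%E.
Proof.
pose E := [set t : R | b < `|t|].
have mE : measurable E by exact: measurable_abs_gt.
have mX : measurable [set w | E (tnth (X w) i)].
  exact: (measurable_funPTI X (measurable_coord i mE)).
have mY y : measurable [set w | Y w = y] by apply: (@measurable_funPTI _ _ _ _ Y [set y]).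
have Phalf y : (P ([set w | E (tnth (X w) i)] `&` [set w | Y w = y]) <=
  (Phi (mu - b))%:E)%E.
  have mEy : measurable [set t | E (t + mean_shift i y)].
    have mf : measurable_fun setT (fun t : R => t + mean_shift i y).
      exact: measurable_funD.
    by have := mf measurableT _ mE; rewrite setTI.
  have : cond_prob P [set w | E (tnth (X w) i)] [set w | Y w = y] <=
         2 * Phi (mu - b).
    rewrite cond_prob_coord// -lee_fin fineK; last exact: fin_num_measure.
    rewrite -[mu - b]opprB; apply: le_trans (normal_prob_tail _).
    apply: le_measure; rewrite ?inE.
    - exact: mEy.
    - exact: measurable_abs_gt.
    - move=> t; rewrite /E /= ltrBlDr => /lt_le_trans; apply.
      apply: (le_trans (ler_normD _ _)); rewrite lerD2l.
      by have /andP[m0 m1] := mean_shift_itv i y; rewrite ger0_norm.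
  have [_ _ PY _] := model.
  rewrite /cond_prob PY /= ler_pdivrMr// -lee_fin fineK; last first.
    by apply: fin_num_measure; exact: measurableI.
  by move=> /le_trans; apply; rewrite lee_fin; lra.
rewrite (_ : [set w | _] =
  ([set w | E (tnth (X w) i)] `&` [set w | Y w = true]) `|`
  ([set w | E (tnth (X w) i)] `&` [set w | Y w = false])); last first.
  apply/seteqP; split=> [w Ew|w [|] []//].
  by case e: (Y w); [left|right].
apply: (le_trans (measureU2 _ _ _)); try exact: measurableI.
by rewrite mulr_natl mulr2n EFinD; apply: leeD; exact: Phalf.
Qed.

End ClassConditionals.

(** * Measurability and the union bound *)

Section MeasurabilityTools.
Context {disp} {T : measurableType disp} {R : realType}.

Lemma measurable_imply (b : bool) (A : set T) :
  measurable A -> measurable [set t | b -> A t].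
Proof.
move=> mA; case: b.
  by rewrite (_ : [set t | _] = A)//; apply/seteqP; split=> t /=; [exact|].
by rewrite (_ : [set t | _] = setT)//; apply/seteqP.
Qed.

Lemma measurable_forall (I : finType) (A : I -> set T) :
  (forall i, measurable (A i)) -> measurable [set t | forall i, A i t].
Proof.
move=> mA; rewrite (_ : [set t | _] = \bigcap_(i in [set: I]) A i).
  by apply: fin_bigcap_measurable => // i _; exact: mA.
by apply/seteqP; split=> t At i; [move=> _|]; exact: At.
Qed.

Lemma measurable_ge_cst (f : T -> R) c :
  measurable_fun setT f -> measurable [set t | c <= f t].
Proof.
move=> mf; rewrite (_ : [set t | _] = f @^-1` `[c, +oo[).
  by rewrite -[X in measurable X]setTI; exact: mf.
by apply/seteqP; split=> t /=; rewrite in_itv/= andbT.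
Qed.

Lemma measurable_between (f : T -> R) c c' :
  measurable_fun setT f -> measurable [set t | c <= f t <= c'].
Proof.
move=> mf; rewrite (_ : [set t | _] = f @^-1` `[c, c']).
  by rewrite -[X in measurable X]setTI; exact: mf.
by apply/seteqP; split=> t /=; rewrite in_itv.
Qed.

Lemma union_bound (P : probability T R) (I : finType) (S : {set I})
    (A : set T) (F : I -> set T) (c : R) :
  measurable A -> (forall i, measurable (F i)) ->
  A `<=` \bigcup_(i in [set` S]) F i -> (forall i, P (F i) <= c%:E)%E ->
  (P A <= (#|S|%:R * c)%:E)%E.
Proof.
move=> mA mF AF Fc.
apply: (le_trans (@content_sub_fsum _ _ _ P _ [set` S] A F _ _ mA AF)) => //.
rewrite (@fsbigE _ _ _ _ _ (enum S)) ?enum_uniq//; last 2 first.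
- by move=> i /=; rewrite fintype.mem_enum.
- by move=> i /= iS; rewrite fintype.mem_enum iS.
apply: (@le_trans _ _ (\sum_(i <- enum S) c%:E)%E).
  rewrite big_mkcond /=; apply: lee_sum => i _; case: ifP => // _.
  exact: le_trans (measure_ge0 P _) (Fc i).
rewrite sumEFin big_const_seq count_predT iter_addr_0 mulr_natl.
by rewrite [size _](_ : _ = #|S|) // cardE.
Qed.

End MeasurabilityTools.

(** * Local regularity of the Gaussian density *)

Section GaussianWindow.
Context {R : realType}.
Implicit Types u v h a : R.
Local Notation phi := (normal_pdf (0 : R) 1).

(** log phi(v) - log phi(u) = (u^2 - v^2) / 2 is at most u (u - v), by concavity
of log phi. *)
Lemma normal_pdf_window u v h : `|v - u| <= h -> h * `|u| <= ln 2 ->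
  phi v <= 2 * phi u.
Proof.
move=> vu hu; rewrite !normal_pdf01E mulrCA ler_pM2l ?invr_gt0 ?sqrt2pi_gt0//.
rewrite -[X in _ <= X * _]lnK ?posrE// -expRD ler_expR.
have : u * (u - v) <= h * `|u|.
  rewrite (le_trans (ler_norm _))// normrM mulrC distrC ler_wpM2r//.
move=> uv; have := sqr_ge0 (u - v); move: uv hu; set m := h * _; nra.
Qed.

(** If |u| <= a, the window around u is controlled by [normal_pdf_window].  If
|u| > a, the window lies beyond a - h, where phi(v) <= phi(a - h) <= 2 phi(a) <= 2 f. *)
Lemma normal_pdf_sup_window (f a h u v : R) : 0 <= h -> h <= a ->
  h * a <= ln 2 -> phi a <= f -> `|v - u| <= h ->
  (phi u < f -> phi v <= 2 * f) /\ (f <= phi u -> phi v <= 2 * phi u).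
Proof.
move=> h0 ha hal fa vu.
have near_u : `|u| <= a -> phi v <= 2 * phi u.
  move=> ua; apply: (normal_pdf_window vu); apply: le_trans hal.
  exact: ler_wpM2l.
split=> [uf|fu]; last first.
  apply: near_u; have := normal_pdf01_le_norm (le_trans fa fu).
  by rewrite (ger0_norm (le_trans h0 ha)).
have [/near_u /le_trans|au] := leP `|u| a.
  by apply; rewrite ler_pM2l// ltW.
apply: (@le_trans _ _ (phi (a - h))).
  apply: le_normal_pdf01; rewrite -(real_normK (num_real v)).
  rewrite lerXn2r ?nnegrE ?subr_ge0//.
  have uv : `|u| <= `|v| + `|v - u| by rewrite -{1}(subKr v u) ler_normB.
  move: uv vu au; lra.
apply: (@le_trans _ _ (2 * phi a)); last by rewrite ler_pM2l.
apply: (@normal_pdf_window _ _ h); first by rewrite addrAC subrr add0r normrN ger0_norm.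
by rewrite (ger0_norm (le_trans h0 ha)).
Qed.

End GaussianWindow.

(** * The trimmed region *)

Section Trimming.
Context {R : realType} {d : nat} {disp} {T : measurableType disp}
  {P : probability T R}.
Variables (X : {RV P >-> d.-tuple R}) (Y : {RV P >-> bool}).
Variables (s'' : nat) (mu : R) (Sig : 'M[R]_d).
Hypothesis model : gaussian_model X Y s'' mu Sig.
Variables (gam J : R) (n : nat) (H : 'I_d -> R).
Implicit Types (i : 'I_d) (y : bool) (t : R).

Local Notation phi := (normal_pdf (0 : R) 1).
Local Notation a := (a_ gam n).
Local Notation h i := (bandwidth (H i) n).
Local Notation flow i := (density_level gam J (H i) n).
Local Notation shift := (mean_shift s'' mu).

Lemma Bf_setT i y t : 0 <= h i -> h i <= a -> h i * a <= ln 2 ->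
  phi a <= flow i -> Bf X Y gam J n H i y t.
Proof.
move=> h0 ha hal fa.
have window t' : t' \in `[t - h i, t + h i] ->
    (cond_pdf X Y i y t < flow i -> cond_pdf X Y i y t' <= 2 * flow i) /\
    (flow i <= cond_pdf X Y i y t ->
     cond_pdf X Y i y t' <= 2 * cond_pdf X Y i y t).
  rewrite in_itv /= => tt'; rewrite !(cond_pdfE model).
  apply: (normal_pdf_sup_window h0 ha hal fa).
  by rewrite opprB addrA subrK ler_distl.
have tt : `[t - h i, t + h i]%classic t by rewrite /= in_itv/= gerBl lerDl h0.
by split=> ft; apply: ge_sup; try (by exists (cond_pdf X Y i y t), t);
  move=> _ [t' tt' <-]; have [w1 w2] := window _ tt'; [exact: w1|exact: w2].
Qed.

(** Left of 0 the lower tails separate and right of mu the upper tails do, both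
by [Phi_shift_ratio].  In between, Phi(t) - Phi(t - mu) is the mass of an
interval of length mu inside [-mu, mu], and Phi(t - mu) <= 1. *)
Lemma Phi_shift_separation t :
  let c := Num.min (expR (mu ^+ 2 / 2) - 1) (mu * phi mu) in
  (1 + c) * Phi (t - mu) <= Phi t \/
  (1 + c) * (1 - Phi t) <= 1 - Phi (t - mu).
Proof.
move=> c; have mu0 := ltW (mu_gt0 model).
have ce : 1 + c <= expR (mu ^+ 2 / 2) by rewrite addrC -lerBrDr ge_min lexx.
have [t0|t0] := leP t 0.
  left; apply: le_trans (Phi_shift_ratio mu0 t0).
  by rewrite ler_wpM2r ?Phi_ge0.
have [tmu|tmu] := leP mu t.
  right; rewrite -!Phi_opp opprB.
  have mut : mu - t <= 0 by rewrite subr_le0.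
  have := Phi_shift_ratio mu0 mut; rewrite addrAC subrr add0r.
  by apply: le_trans; rewrite ler_wpM2r ?Phi_ge0.
left; have [|e /andP[e1 e2] eE] := @Phi_sub R (t - mu) t.
  by rewrite gerBl.
have ee : mu * phi mu <= Phi t - Phi (t - mu).
  rewrite eE opprB addrCA subrr addr0 mulrC ler_wpM2r// le_normal_pdf01//; nra.
have c1 : c * Phi (t - mu) <= mu * phi mu.
  have c2 : c <= mu * phi mu by rewrite ge_min lexx orbT.
  apply: le_trans (_ : mu * phi mu * Phi (t - mu) <= _).
    by rewrite ler_wpM2r ?Phi_ge0.
  rewrite ger_pMr ?Phi_le1// mulr_gt0 ?normal_pdf01_gt0//; exact: mu_gt0 model.
by rewrite mulrDl mul1r; lra.
Qed.

Lemma Bdelta_setT i t : (i < s'')%N ->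
  @ratio_threshold R d gam n <
    1 + Num.min (expR (mu ^+ 2 / 2) - 1) (mu * phi mu) ->
  Bdelta X Y gam n i t.
Proof.
move=> is'' thr; have := Phi_shift_separation t.
set c := 1 + _ in thr * => -[ct|ct]; [exists false; left|exists true; right].
  rewrite !(cond_cdfE model) /mean_shift is'' /= subr0 (lt_le_trans thr)//.
  by rewrite ler_pdivlMr ?Phi_gt0.
rewrite !(cond_cdfE model) /mean_shift is'' /= subr0 (lt_le_trans thr)//.
by rewrite ler_pdivlMr ?subr_gt0 ?Phi_lt1.
Qed.


(** The inequalities between the rates that hold for n large enough. *)
Section Regime.
Hypothesis h_ge0 : forall i, 0 <= h i.
Hypothesis h_le : forall i, h i <= a.
Hypothesis ha_le : forall i, h i * a <= ln 2.
Hypothesis pdf_le_flow : forall i, phi a <= flow i.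
Hypothesis threshold_lt : @ratio_threshold R d gam n <
  1 + Num.min (expR (mu ^+ 2 / 2) - 1) (mu * phi mu).
Hypothesis g_le : 8 * g_ gam (2 * n) <= mu * phi a.
Hypothesis flow_le : forall i,
  3 / (1 - eps_ gam n) * flow i <= phi (a - mu).
Hypothesis a_ge : 1 + 3 * mu <= a.
Variable x0 : d.-tuple R.

(** The conditions of A_ on the i-th coordinate that can fail; S' is taken at
x0, as it does not depend on the point. *)
Definition good i : set R := [set t |
  ((i < s'')%N -> forall y,
     8 * g_ gam (2 * n) <= cond_cdf X Y i y t <= 1 - 8 * g_ gam (2 * n)) /\
  (i \in S1 X Y Sig x0 -> forall y, - a <= alpha X Y i y t <= a) /\
  (dlogf X Y i t != 0 -> Af_coord X Y gam J n H i t)].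

(** Beyond isolating the conditions that matter, this form shows that A_ is
measurable, which monotonicity of P requires. *)
Lemma A_goodE :
  A_ X Y gam J n Sig H = [set x | forall i, good i (tnth x i)].
Proof.
have Bf_all i y t : Bf X Y gam J n H i y t by exact: Bf_setT.
apply/seteqP; split=> x.
  move=> [[[AFx AFbx] _] Afx] i; split; [|split] => [is''|iS1 y|fi].
  - have [|[B0 B1] _] := AFx i; first by rewrite (in_S2 model).
    by case.
  - by apply: AFbx; rewrite (S1_cst model x x0).
  - by have [] := Afx i; [rewrite /Sf finset.inE|].
move=> gx; split; [split; [split|]|] => i.
- rewrite (in_S2 model) => is''; have [/(_ is'') Bi _] := gx i.
  split; [split; [exact: (Bi false)|exact: (Bi true)]|exact: Bdelta_setT].
- by rewrite (S1_cst model x x0) => iS1 y; have [_ [+ _]] := gx i; exact.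
- by move=> _ y; exact: Bf_all.
- rewrite /Sf finset.inE => fi; have [_ [_ /(_ fi) Ai]] := gx i.
  by split=> // y; exact: Bf_all.
Qed.

Lemma measurable_good i : measurable (good i).
Proof.
apply: measurableI; [|apply: measurableI].
- apply: measurable_imply; apply: measurable_forall => y.
  exact: (measurable_between _ _ (measurable_cond_cdf model i y)).
- apply: measurable_imply; apply: measurable_forall => y.
  exact: (measurable_between _ _ (measurable_alpha model i y)).
- rewrite [X in measurable X](_ : _ =
    dlogf X Y i @^-1` [set 0] `|` Af_coord X Y gam J n H i).
    apply: measurableU.
      rewrite -[X in measurable X]setTI; apply: (measurable_dlogf model) => //.
    apply: measurable_forall => y.
    exact: (measurable_ge_cst _ (measurable_cond_pdf model i y)).
  apply/seteqP; split=> t /=.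
    by have [->|f0 ft] := eqVneq (dlogf X Y i t) 0; [left|right; exact: ft].
  by move=> [->|//]; rewrite eqxx.
Qed.

Lemma good_small i t : `|t| <= a - 2 * mu -> good i t.
Proof.
move=> ta; have mu0 := mu_gt0 model.
have ub y : `|t - shift i y| <= a - mu.
  rewrite (le_trans (ler_normB _ _))//.
  have /andP[m0 m1] := mean_shift_itv model i y; rewrite (ger0_norm m0).
  by move: ta m1; lra.
have Plow u : - (a - mu) <= u -> 8 * g_ gam (2 * n) <= Phi u.
  move=> ua; have := Phi_mono (- (a - mu)) u; rewrite ua.
  apply: le_trans; apply: (le_trans g_le).
  rewrite -[X in phi X](subrK mu); apply: Phi_lower; first exact: ltW.
  by move: a_ge mu0; lra.
split=> [is'' y|]; last split=> [_ y|_ y].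
- rewrite (cond_cdfE model); have /ler_normlP[u1 u2] := ub y.
  rewrite Plow; last by rewrite lerNl.
  by rewrite lerBrDl -lerBrDr -Phi_opp Plow// lerN2.
- rewrite (alphaE model); have /ler_normlP[u1 u2] := ub y.
  by apply/andP; split; move: u1 u2 mu0; lra.
- rewrite (cond_pdfE model) (le_trans (flow_le i))//.
  apply: le_normal_pdf01; rewrite -(real_normK (num_real (t - _))).
  by rewrite lerXn2r ?nnegrE// (le_trans (normr_ge0 _) (ub y)).
Qed.

(** A coordinate outside of S' with index at least s'' has the same law in both
classes, so that no condition that can fail bears on it. *)
Lemma good_inactive i t :
  (s'' <= i)%N -> i \notin S1 X Y Sig x0 -> good i t.
Proof.
move=> si iS; split; [|split].
- by rewrite ltnNge si.
- by rewrite (negbTE iS).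
- by rewrite (dlogf0 model)// eqxx.
Qed.

Lemma prob_not_A :
  (P [set w | ~ A_ X Y gam J n Sig H (X w)] <=
   ((#|S1 X Y Sig x0| + s'')%:R * (2 * phi (a - 3 * mu)))%:E)%E.
Proof.
pose S : {set 'I_d} := finset (fun i : 'I_d => (i < s'')%N).
have mu0 := mu_gt0 model.
have cardS : (#|S1 X Y Sig x0 :|: S| <= #|S1 X Y Sig x0| + s'')%N.
  apply: (leq_trans (leq_card_setU _ _)); rewrite leq_add2l.
  have [/andP[_ sd] _ _ _] := model.
  have winj : injective (widen_ord sd).
    by move=> i j ij; apply/val_inj; exact: (congr1 val ij).
  rewrite -[leqRHS](card_ord s'') -(card_imset _ winj).
  apply/subset_leq_card/fintype.subsetP => i; rewrite finset.inE => is''.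
  by apply/imsetP; exists (Ordinal is'') => //; apply: val_inj.
apply: (@le_trans _ _ (#|S1 X Y Sig x0 :|: S|%:R * (2 * phi (a - 3 * mu)))%:E); last first.
  by rewrite lee_fin ler_wpM2r ?ler_nat// mulr_ge0// normal_pdf_ge0.
pose F i := [set w | a - 2 * mu < `|tnth (X w) i|].
apply: (@union_bound _ _ _ P _ _ _ F).
- rewrite A_goodE; apply: measurableC.
  apply: (measurable_funPTI X); apply: measurable_forall => i.
  exact: measurable_coord (measurable_good i).
- move=> i.
  exact (measurable_funPTI X (measurable_coord i (measurable_abs_gt _))).
- move=> w /=; rewrite A_goodE /= => /existsNP[i gi]; exists i => /=.
    rewrite finset.inE; apply: contra_notT gi; rewrite negb_or => /andP[iS].
    by rewrite finset.inE -leqNgt => si; exact: good_inactive.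
  by rewrite /F /= ltNge; apply: contra_notN gi; exact: good_small.
- move=> i; apply: (le_trans (coord_tail model i (a - 2 * mu))).
  rewrite lee_fin ler_pM2l//.
  have -> : mu - (a - 2 * mu) = - (a - 3 * mu) by ring.
  rewrite -(normal_pdf01_opp (a - _)) Phi_le_normal_pdf//.
  by move: a_ge; lra.
Qed.

End Regime.
End Trimming.

(** * Comparison of the rates *)

Section Asymptotics.
Context {R : realType}.
Implicit Types (gam Cd mu c delta p : R) (n : nat).
Local Notation phi := (normal_pdf (0 : R) 1).

Lemma ln_nat_cvgy : (ln n%:R : R) @[n --> \oo] --> +oo.
Proof.
apply/cvgryPge => A; near=> n.
have An : expR A <= n%:R by near: n; exact: nbhs_infty_ger.
by rewrite -(expRK A) ler_ln ?posrE ?expR_gt0// (lt_le_trans (expR_gt0 A)).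
Unshelve. all: by end_near. Qed.

Lemma a_cvgy gam : 0 < gam -> (a_ gam n : R) @[n --> \oo] --> +oo.
Proof.
move=> gam0; apply/cvgryPge => A; near=> n.
have AL : A ^+ 2 / gam <= ln n%:R.
  by near: n; exact: (cvgry_ge ln_nat_cvgy).
rewrite (le_trans (ler_norm A))// -sqrtr_sqr /a_ ler_wsqrtr//.
by rewrite mulrC -ler_pdivrMr.
Unshelve. all: by end_near. Qed.

(** Every comparison of rates reduces to this one, at x = a_n or x = ln n. *)
Lemma expR_dominates p c : 0 < p ->
  \forall x \near +oo, c * x ^+ 2 <= expR (p * x).
Proof.
move=> p0; near=> x.
have x0 : 0 <= x by near: x; apply: nbhs_pinfty_ge; rewrite num_real.
have cx : c * 6 / p ^+ 3 <= x by near: x; apply: nbhs_pinfty_ge; rewrite num_real.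
have : 1 + (p * x) ^+ 3 / 3`!%:R <= expR (p * x).
  by apply: expR_ge1Dxn; rewrite mulr_ge0// ltW.
apply: le_trans; rewrite -[leLHS]add0r lerD//.
rewrite exprMn ler_pdivlMr// mulrAC.
move: cx; rewrite ler_pdivrMr ?exprn_gt0// => cx.
have := ler_wpM2r (sqr_ge0 x) cx.
rewrite (_ : 3`!%:R = 6) // => /le_trans; apply.
by have -> : x * p ^+ 3 * x ^+ 2 = p ^+ 3 * x ^+ 3 by ring.
Unshelve. all: by end_near. Qed.

Lemma powR_expR_ln p n : (0 < n)%N -> n%:R `^ p = expR (p * ln n%:R) :> R.
Proof. by move=> n0; rewrite /powR pnatr_eq0 -leqn0 leqNgt n0. Qed.

Lemma sqr_a gam n : 0 < gam -> (0 < n)%N -> a_ gam n ^+ 2 = gam * ln n%:R.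
Proof.
move=> gam0 n0; rewrite sqr_sqrtr// mulr_ge0 ?(ltW gam0)// ln_ge0//.
by rewrite ler1n.
Qed.

Lemma normal_pdf_a_sub gam c n : 0 < gam -> (0 < n)%N ->
  phi (a_ gam n - c) = (Num.sqrt (2 * pi))^-1 * n%:R `^ (- (gam / 2)) *
    expR (c * a_ gam n - c ^+ 2 / 2).
Proof.
move=> gam0 n0; rewrite normal_pdf01E powR_expR_ln// -mulrA -expRD.
congr (_ * expR _); rewrite sqrrB (sqr_a gam0 n0); by field.
Qed.

Lemma le_a_double gam n : 0 < gam -> (0 < n)%N -> a_ gam n <= a_ gam (2 * n).
Proof.
move=> gam0 n0; rewrite /a_ ler_wsqrtr// ler_pM2l// ler_ln ?posrE ?ltr0n ?muln_gt0//.
by rewrite ler_nat leq_pmull.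
Qed.

Lemma ln2_le1 : ln 2 <= 1 :> R.
Proof. by have := @le_ln1Dx R 1; apply; rewrite (lt_trans _ ltr01)// ltrN10. Qed.

Lemma a_double_le gam n : 0 < gam < 2 -> (0 < n)%N -> 1 <= a_ gam n ->
  a_ gam (2 * n) <= 2 * a_ gam n.
Proof.
move=> /andP[gam0 gam2] n0 a1.
have a0 : 0 <= 2 * a_ gam n by rewrite mulr_ge0// sqrtr_ge0.
rewrite -(ler_pXn2r (n := 2)) ?nnegrE ?sqrtr_ge0//.
rewrite exprMn !sqr_a ?muln_gt0// natrM lnM ?posrE ?ltr0n//.
have := sqr_a gam0 n0; have ln2 : ln 2 <= 1 :> R := ln2_le1.
have : 1 <= a_ gam n ^+ 2 by rewrite exprn_ege1.
have ln20 : 0 <= ln 2 :> R by rewrite ln_ge0//; lra.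
nra.
Qed.

Lemma powR_double gam n : 0 < gam < 2 -> (0 < n)%N ->
  ((2 * n)%:R : R) `^ (- (gam / 2)) <= n%:R `^ (- (gam / 2)) <=
    2 * (2 * n)%:R `^ (- (gam / 2)).
Proof.
move=> /andP[gam0 gam2] n0; rewrite natrM powRM//.
have p0 : 0 < n%:R `^ (- (gam / 2)) :> R by rewrite powR_gt0 ?ltr0n.
have l2 : (2 : R) `^ (- (gam / 2)) <= 1.
  by rewrite -[leRHS](powRr0 2) ler_powR//; lra.
have l1 : 1 <= 2 * (2 : R) `^ (- (gam / 2)).
  rewrite -{1}(powRr1 (ler0n R 2)) -powRD; last by apply/implyP => _; rewrite pnatr_eq0.
  by rewrite -[leLHS](powRr0 2) ler_powR//; lra.
by apply/andP; split; nra.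
Qed.


Lemma near_g_le gam mu : 0 < gam < 2 -> 0 < mu ->
  \forall n \near \oo, 8 * g_ gam (2 * n) <= mu * phi (a_ gam n).
Proof.
move=> gam02 mu0; have /andP[gam0 gam2] := gam02; near=> n.
have n0 : (0 < n)%N by near: n; exists 1%N.
have a0 : 0 < a_ gam n by near: n; exact: (cvgry_gt (a_cvgy gam0)).
have amu : 4 / mu <= a_ gam n by near: n; exact: (cvgry_ge (a_cvgy gam0)).
have := normal_pdf_a_sub 0 gam0 n0.
rewrite subr0 mul0r expr0n /= mul0r subr0 expR0 mulr1 => ->.
have aa := le_a_double gam0 n0.
rewrite /g_ -/(a_ gam (2 * n)) invfM.
have s0 := @sqrt2pi_gt0 R; set s := Num.sqrt (2 * pi) in s0 *.
set b := a_ gam (2 * n) in aa *; have b0 : 0 < b := lt_le_trans a0 aa.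
have /andP[pn _] := powR_double gam02 n0.
set q := (2 * n)%:R `^ _ in pn *; set r := n%:R `^ _ in pn *.
have r0 : 0 <= r by exact: powR_ge0.
rewrite (_ : 8 * _ = s^-1 * (4 * (q / b))); last by field; rewrite !gt_eqF.
rewrite [mu * _]mulrCA ler_pM2l ?invr_gt0//.
rewrite mulrA ler_pdivrMr//.
rewrite ler_pdivrMr// in amu.
apply: (@le_trans _ _ (4 * r)); first by rewrite ler_pM2l.
rewrite mulrAC ler_wpM2r// (le_trans amu)// mulrC ler_pM2l//.
Unshelve. all: by end_near. Qed.

(** The quotient of phi(a_n - 3 mu) by g(2n) is of order a_n e^{3 mu a_n}. *)
Lemma near_tail_le_g gam mu : 0 < gam < 2 -> 0 < mu ->
  \forall n \near \oo, 2 * phi (a_ gam n - 3 * mu) <=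
    expR (4 * mu * a_ gam n) * g_ gam (2 * n).
Proof.
move=> gam02 mu0; have /andP[gam0 gam2] := gam02; near=> n.
have n0 : (0 < n)%N by near: n; exists 1%N.
have a1 : 1 <= a_ gam n by near: n; exact: (cvgry_ge (a_cvgy gam0)).
have amu : 16 * a_ gam n ^+ 2 <= expR (mu * a_ gam n).
  by near: n; exact: (a_cvgy gam0 (expR_dominates 16 mu0)).
rewrite (normal_pdf_a_sub _ gam0 n0).
have ab := a_double_le gam02 n0 a1.
have aa := le_a_double gam0 n0.
rewrite /g_ -/(a_ gam (2 * n)) invfM.
have s0 := @sqrt2pi_gt0 R; set s := Num.sqrt (2 * pi) in s0 *.
set b := a_ gam (2 * n) in aa ab *.
have b0 : 0 < b by rewrite (lt_le_trans ltr01)// (le_trans a1).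
have /andP[_ pn] := powR_double gam02 n0.
set q := (2 * n)%:R `^ _ in pn *; set r := n%:R `^ _ in pn *.
have r0 : 0 <= q by exact: powR_ge0.
have e1 : expR (3 * mu * a_ gam n - (3 * mu) ^+ 2 / 2) <=
          expR (3 * mu * a_ gam n).
  by rewrite ler_expR gerBl divr_ge0// sqr_ge0.
set F := expR (_ - _) in e1 *.
rewrite (_ : 4 * mu * a_ gam n = mu * a_ gam n + 3 * mu * a_ gam n); last by ring.
rewrite expRD.
have e30 := expR_gt0 (3 * mu * a_ gam n).
set E := expR (3 * mu * a_ gam n) in e1 e30 *.
set G := expR _ in amu *.
have bG : 8 * b <= G.
  apply: le_trans amu; have : a_ gam n <= a_ gam n ^+ 2 by rewrite ler_eXnr.
  by move: ab; lra.
apply: (@le_trans _ _ (2 * (s^-1 * (2 * q) * E))).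
  rewrite ler_pM2l//; apply: ler_pM => //.
  - by rewrite mulr_ge0 ?powR_ge0// invr_ge0 ltW.
  - exact: expR_ge0.
  - by rewrite ler_pM2l ?invr_gt0.
rewrite (_ : _ * E * _ = s^-1 * (q * E * (G / b / 2))); last first.
  by field; rewrite !gt_eqF.
rewrite (_ : 2 * _ = s^-1 * (q * E * 4)); last by field; rewrite gt_eqF.
rewrite ler_pM2l ?invr_gt0// ler_wpM2l ?mulr_ge0 ?(ltW e30)//.
rewrite -mulrA -invfM ler_pdivlMr ?mulr_gt0//.
by move: bG; lra.
Unshelve. all: by end_near. Qed.

Lemma near_eps_le gam : 0 < gam < 2 ->
  \forall n \near \oo, eps_ gam n <= 1 / 2 :> R.
Proof.
move=> gam02; have /andP[gam0 gam2] := gam02.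
set k : R := (2 * @J1 R) `^ (- (1 / 2)).
have p0 : 0 < 1 / 2 - gam / 4 by lra.
near=> n.
have n0 : (0 < n)%N by near: n; exists 1%N.
have L1 : 1 <= gam * ln n%:R.
  rewrite -(sqr_a gam0 n0) exprn_ege1//.
  by near: n; exact: (cvgry_ge (a_cvgy gam0)).
have L2 : 1 <= ln n%:R :> R by near: n; exact: (cvgry_ge ln_nat_cvgy).
have dom : 2 * k * gam * ln n%:R ^+ 2 <= expR ((1 / 2 - gam / 4) * ln n%:R).
  by near: n; exact: (ln_nat_cvgy (expR_dominates _ p0)).
rewrite /eps_ -/k powR_expR_ln// mulNr expRN ler_pdivrMr ?expR_gt0//.
have k0 : 0 <= k by exact: powR_ge0.
have : (gam * ln n%:R) `^ (3 / 4) <= gam * ln n%:R.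
  by rewrite -[leRHS]powRr1 ?ler_powR//; lra.
have LL : gam * ln n%:R <= gam * ln n%:R ^+ 2 by rewrite ler_pM2l// ler_eXnr.
move=> /le_trans /(_ LL) /(ler_wpM2l k0) /le_trans; apply.
by move: dom; lra.
Unshelve. all: by end_near. Qed.

(** With L = ln n, the square of bar_delta is of order at most
L^2 e^{- (1 - gamma/2) L}, for ln(d n^{gamma/2}) is at most
(Cd + gamma/2) L and 1 / g(2n) is of order a_n e^{gamma L / 2}. *)
Lemma near_bar_delta_le gam Cd delta : 0 < gam < 2 -> 0 < Cd -> 0 < delta ->
  \forall n \near \oo, forall D : nat, (0 < D)%N -> D%:R <= n%:R `^ Cd ->
    bar_delta gam n D <= delta.
Proof.
move=> gam02 Cd0 delta0; have /andP[gam0 gam2] := gam02.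
have s0 := @sqrt2pi_gt0 R; pose s : R := Num.sqrt (2 * pi).
have p0 : 0 < 1 - gam / 2 by lra.
pose k := 3 * (8 * s * gam) * (Cd + gam / 2) / delta ^+ 2.
near=> n => D D0 Dn.
have n0 : (0 < n)%N by near: n; exists 1%N.
have a1 : 1 <= a_ gam n by near: n; exact: (cvgry_ge (a_cvgy gam0)).
have L2 : 0 <= ln n%:R :> R by rewrite ln_ge0// ler1n.
have dom : k * ln n%:R ^+ 2 <= expR ((1 - gam / 2) * ln n%:R).
  by near: n; exact: (ln_nat_cvgy (expR_dominates _ p0)).
rewrite /bar_delta -(ger0_norm (ltW delta0)) -sqrtr_sqr ler_wsqrtr//.
have n00 : 0 < n%:R :> R by rewrite ltr0n.
have lnD : ln (D%:R * n%:R `^ (gam / 2)) <= (Cd + gam / 2) * ln n%:R.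
  rewrite lnM ?posrE ?ltr0n ?powR_gt0// ln_powR mulrDl lerD2r.
  by rewrite -ln_powR ler_ln ?posrE ?ltr0n ?powR_gt0.
have lnD0 : 0 <= (Cd + gam / 2) * ln n%:R.
  by rewrite mulr_ge0// addr_ge0 ?ltW// divr_gt0.
have ab := a_double_le gam02 n0 a1.
have b1 : 1 <= a_ gam (2 * n) by rewrite (le_trans a1)// le_a_double.
have b0 := lt_le_trans ltr01 b1.
have /andP[_ pn] := powR_double gam02 n0.
have q0 : 0 < (2 * n)%:R `^ (- (gam / 2)) :> R.
  by rewrite powR_gt0// ltr0n muln_gt0.
have e0 := expR_gt0 (gam / 2 * ln n%:R).
have ginv : (g_ gam (2 * n))^-1 <= 8 * s * gam * ln n%:R * expR (gam / 2 * ln n%:R).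
  rewrite /g_ -/(a_ gam (2 * n)) -/s invfM invrK invf_div.
  have aL : a_ gam (2 * n) <= 2 * (gam * ln n%:R).
    by rewrite -(sqr_a gam0 n0) (le_trans ab)// ler_pM2l// ler_eXnr.
  have qinv : ((2 * n)%:R `^ (- (gam / 2)))^-1 <= 2 * expR (gam / 2 * ln n%:R).
    rewrite -[leRHS]invrK lef_pV2 ?posrE ?invr_gt0 ?mulr_gt0//.
    rewrite invfM -expRN -mulNr -powR_expR_ln// mulrC ler_pdivrMr//.
    by rewrite [leRHS]mulrC.
  rewrite (_ : 8 * s * gam * _ * _ =
    2 * s * (2 * (gam * ln n%:R) * (2 * expR (gam / 2 * ln n%:R)))); last by ring.
  rewrite ler_wpM2l ?mulr_ge0 ?(ltW s0)// ler_pM ?invr_ge0//; exact: ltW.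
rewrite powR_expR_ln // in Dn.
have nE : n%:R^-1 = expR (- ln n%:R) :> R by rewrite expRN lnK ?posrE.
apply: (@le_trans _ _ (3 * n%:R^-1 *
    (8 * s * gam * ln n%:R * expR (gam / 2 * ln n%:R)) *
    ((Cd + gam / 2) * ln n%:R))).
  have g0 : 0 <= (g_ gam (2 * n))^-1.
    by rewrite invr_ge0 /g_ mulr_ge0 ?invr_ge0 ?mulr_ge0 ?divr_ge0 ?sqrtr_ge0 ?powR_ge0.
  apply: (@le_trans _ _ (3 * n%:R^-1 * (g_ gam (2 * n))^-1 *
    ((Cd + gam / 2) * ln n%:R))).
    by rewrite ler_wpM2l// !mulr_ge0// invr_ge0 ltW.
  by rewrite ler_wpM2r// ler_wpM2l// mulr_ge0// invr_ge0 ltW.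
rewrite nE [leLHS](_ : _ = k * ln n%:R ^+ 2 * delta ^+ 2 *
    expR (- ln n%:R + gam / 2 * ln n%:R)); last first.
  by rewrite expRD /k; field; rewrite gt_eqF.
rewrite mulrAC ler_piMl ?sqr_ge0//.
rewrite (_ : - ln n%:R + _ = - ((1 - gam / 2) * ln n%:R)); last by ring.
by rewrite expRN ler_pdivrMr ?expR_gt0// mul1r.
Unshelve. all: by end_near. Qed.

Lemma near_ratio_threshold_lt gam Cd c : 0 < gam < 2 -> 0 < Cd -> 0 < c ->
  \forall n \near \oo, forall D : nat, (0 < D)%N -> D%:R <= n%:R `^ Cd ->
    @ratio_threshold R D gam n < 1 + c.
Proof.
move=> gam02 Cd0 c0.
(* ((1 + delta) / (1 - delta))^2 < 1 + c amounts to
   delta (2 c + 4) < c + c delta^2. *)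
pose delta : R := c / (2 * c + 6).
have delta0 : 0 < delta by rewrite divr_gt0//; lra.
have near_bd := near_bar_delta_le gam02 Cd0 delta0.
near=> n => D D0 Dn.
have n0 : (0 < n)%N by near: n; exists 1%N.
have bd : forall D : nat, (0 < D)%N -> D%:R <= n%:R `^ Cd ->
    bar_delta gam n D <= delta by near: n.
have dD := bd D D0 Dn.
have d1 : bar_delta gam n 1 <= delta.
  apply: bd => //; rewrite -[leLHS](powRr0 (n%:R : R)) ler_powR ?ler1n//.
  exact: ltW.
have x0 : 0 <= bar_delta gam n D by exact: sqrtr_ge0.
have y0 : 0 <= bar_delta gam n 1 by exact: sqrtr_ge0.
rewrite /ratio_threshold.
set x := bar_delta gam n D in dD x0 *; set y := bar_delta gam n 1 in d1 y0 *.
have dE : delta * (2 * c + 6) = c by rewrite /delta divfK// gt_eqF//; lra.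
have dlt : delta <= 1 / 2 by rewrite /delta ler_pdivrMr; lra.
have x1 : 0 < 1 - x by lra.
have y1 : 0 < 1 - y by lra.
rewrite ltr_pdivrMr ?mulr_gt0//.
apply: (@le_lt_trans _ _ ((1 + delta) * (1 + delta))).
  by apply: ler_pM; lra.
apply: (@lt_le_trans _ _ ((1 + c) * ((1 - delta) * (1 - delta)))).
  nra.
by rewrite ler_pM2l; [apply: ler_pM; lra|lra].
Unshelve. all: by end_near. Qed.

End Asymptotics.

Section LevelBounds.
Context {R : realType}.
Implicit Types (gam J mu H : R) (n : nat).
Local Notation phi := (normal_pdf (0 : R) 1).

Lemma bandwidth_bounds gam H n : 0 < gam -> 1 <= a_ gam n -> (0 < n)%N ->
  0 < H <= ln 2 / Num.sqrt gam ->
  [/\ 0 <= bandwidth H n, bandwidth H n <= a_ gam n &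
      bandwidth H n * a_ gam n <= ln 2].
Proof.
move=> gam0 a1 n0 /andP[H0 Hle].
have sg0 : 0 < Num.sqrt gam by rewrite sqrtr_gt0.
have h0 : 0 <= bandwidth H n by rewrite divr_ge0 ?sqrtr_ge0 ?ltW.
have aE : a_ gam n = Num.sqrt gam * Num.sqrt (ln n%:R).
  by rewrite /a_ sqrtrM// ltW.
have sL0 : 0 < Num.sqrt (ln n%:R : R).
  by rewrite -(pmulr_rgt0 _ sg0) -aE (lt_le_trans ltr01).
have ha : bandwidth H n * a_ gam n <= ln 2.
  rewrite aE /bandwidth mulrCA divfK ?gt_eqF// mulrC.
  by rewrite -ler_pdivlMr.
split=> //; apply: (le_trans _ a1); have := ln2_le1 (R := R).
by move: (ler_wpM2l h0 a1) ha; rewrite mulr1; lra.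
Qed.

(** phi(a_n) is n^{-gamma/2} / sqrt(2 pi), and the level carries a further
factor ln n that no bounded 1 / H can undo. *)
Lemma near_pdf_le_level gam J : 0 < gam < 2 -> 0 < J ->
  \forall n \near \oo, forall H, 0 < H <= ln 2 / Num.sqrt gam ->
    phi (a_ gam n) <= density_level gam J H n.
Proof.
move=> gam02 J0; have /andP[gam0 gam2] := gam02; near=> n => H /andP[H0 Hle].
have n0 : (0 < n)%N by near: n; exists 1%N.
have s0 := @sqrt2pi_gt0 R; pose s : R := Num.sqrt (2 * pi).
have L : ln 2 / Num.sqrt gam / (J * s) <= ln n%:R.
  by near: n; exact: (cvgry_ge ln_nat_cvgy).
have := normal_pdf_a_sub 0 gam0 n0.
rewrite subr0 mul0r expr0n /= mul0r subr0 expR0 mulr1 => ->.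
rewrite /density_level ler_wpM2r ?powR_ge0//.
rewrite ler_pdivrMr ?mulr_gt0// in L.
have HL := le_trans Hle L.
rewrite (_ : J * H^-1 * _ = ln n%:R * (J * s) / H / s); last first.
  by field; rewrite !gt_eqF.
by rewrite ler_pdivlMr// mulVf ?gt_eqF// ler_pdivlMr// mul1r.
Unshelve. all: by end_near. Qed.

(** The level is largest at H = Hmin, and e^{mu a_n} outgrows
ln n = a_n^2 / gamma whatever the constant 1 / Hmin. *)
Lemma near_level_le_pdf gam J mu Hmin : 0 < gam < 2 -> 0 < J -> 0 < mu ->
  0 < Hmin ->
  \forall n \near \oo, forall H, Hmin <= H ->
    3 / (1 - eps_ gam n) * density_level gam J H n <= phi (a_ gam n - mu).
Proof.
move=> gam02 J0 mu0 Hmin0; have /andP[gam0 gam2] := gam02.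
have s0 := @sqrt2pi_gt0 R; pose s : R := Num.sqrt (2 * pi).
pose k := 6 * J / Hmin * s * expR (mu ^+ 2 / 2) / gam.
near=> n => H HH.
have n0 : (0 < n)%N by near: n; exists 1%N.
have eps2 : eps_ gam n <= 1 / 2 by near: n; exact: near_eps_le.
have dom : k * a_ gam n ^+ 2 <= expR (mu * a_ gam n).
  by near: n; exact: (a_cvgy gam0 (expR_dominates _ mu0)).
have L0 : 0 <= ln n%:R :> R by rewrite ln_ge0// ler1n.
have H0 := lt_le_trans Hmin0 HH.
rewrite (normal_pdf_a_sub _ gam0 n0) /density_level.
rewrite mulrA [leRHS]mulrAC ler_wpM2r ?powR_ge0//.
apply: (@le_trans _ _ (6 * (J * Hmin^-1 * ln n%:R))).
  apply: ler_pM.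
  - by rewrite divr_ge0//; lra.
  - exact: mulr_ge0 (divr_ge0 (ltW J0) (ltW H0)) L0.
  - by rewrite ler_pdivrMr; lra.
  - by rewrite ler_wpM2r// ler_pM2l// lef_pV2.
rewrite expRD expRN -/s.
rewrite (sqr_a gam0 n0) in dom.
rewrite [leRHS]mulrA ler_pdivlMr ?expR_gt0// [leRHS]mulrC ler_pdivlMr//.
apply: le_trans dom; rewrite le_eqVlt; apply/orP; left; apply/eqP.
by rewrite /k; field; rewrite !gt_eqF.
Unshelve. all: by end_near. Qed.

End LevelBounds.

Theorem theorem2p14 (R : realType) :
  exists C : R,
  forall gam Cd J mu : R,
    0 < gam < 2 -> 0 < Cd -> 0 < J -> 0 < mu ->
  exists K : R,
  forall (d s'' s : nat -> nat) (kappa M : nat -> R)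
    (Sig : forall n, 'M[R]_(d n)) (H : forall n, 'I_(d n) -> R) (Hmin : R),
    (\forall n \near \oo, (d n)%:R <= n%:R `^ Cd) ->
    (forall n, class_U (s n) (M n) (kappa n) (invmx (Sig n))) ->
    (fun n : nat => kappa n * (s n)%:R * Num.sqrt (ln n%:R) *
                    lambda_ gam n (d n)) =o_\oo (fun n : nat => eps_ gam n) ->
    0 < Hmin ->
    (forall n i, Hmin <= H n i <= ln 2 / Num.sqrt gam) ->
    (\forall n \near \oo,
       forall disp (T : measurableType disp) (P : probability T R)
         (X : {RV P >-> (d n).-tuple R}) (Y : {RV P >-> bool}),
         gaussian_model X Y (s'' n) mu (Sig n) ->
         kde_deviation X Y gam J n (H n)) ->
    \forall n \near \oo,
      forall disp (T : measurableType disp) (P : probability T R)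
        (X : {RV P >-> (d n).-tuple R}) (Y : {RV P >-> bool}),
        gaussian_model X Y (s'' n) mu (Sig n) ->
      forall x : (d n).-tuple R,
        (P [set w | ~ A_ X Y gam J n (Sig n) (H n) (X w)] <=
         (K * (#|S1 X Y (Sig n) x| + s'' n)%:R *
          expR (C * mu * Num.sqrt (gam * ln n%:R)) * g_ gam (2 * n))%:E)%E.
Proof.
exists 4 => gam Cd J mu gam02 Cd0 J0 mu0; exists 1.
move=> d s'' s kappa M Sig H Hmin dn _ _ Hmin0 HH _.
have /andP[gam0 gam2] := gam02.
have c0 : 0 < Num.min (expR (mu ^+ 2 / 2) - 1) (mu * normal_pdf 0 1 mu).
  rewrite lt_min mulr_gt0 ?normal_pdf01_gt0// andbT subr_gt0 expR_gt1.
  by rewrite divr_gt0// exprn_gt0.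
have near_thr := near_ratio_threshold_lt gam02 Cd0 c0.
have near_flow := near_pdf_le_level gam02 J0.
have near_flow' := near_level_le_pdf gam02 J0 mu0 Hmin0.
near=> n => disp T P X Y model x.
have flow_ge : forall h, 0 < h <= ln 2 / Num.sqrt gam ->
    normal_pdf 0 1 (a_ gam n) <= density_level gam J h n by near: n.
have flow_le : forall h, Hmin <= h ->
    3 / (1 - eps_ gam n) * density_level gam J h n <=
    normal_pdf 0 1 (a_ gam n - mu) by near: n.
have thr : forall D : nat, (0 < D)%N -> D%:R <= n%:R `^ Cd ->
    @ratio_threshold R D gam n <
    1 + Num.min (expR (mu ^+ 2 / 2) - 1) (mu * normal_pdf 0 1 mu) by near: n.
have n0 : (0 < n)%N by near: n; exists 1%N.
have a1 : 1 <= a_ gam n by near: n; exact: (cvgry_ge (a_cvgy gam0)).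
have amu : 1 + 3 * mu <= a_ gam n by near: n; exact: (cvgry_ge (a_cvgy gam0)).
have HH' i : 0 < H n i <= ln 2 / Num.sqrt gam.
  by have /andP[h1 ->] := HH n i; rewrite (lt_le_trans Hmin0 h1).
have d0 : (0 < d n)%N.
  by have [/andP[s1 s2] _ _ _] := model; exact: leq_trans s1 s2.
have hb i := bandwidth_bounds gam0 a1 n0 (HH' i).
apply: (le_trans (@prob_not_A R _ _ _ P X Y _ _ _ model gam J n (H n) _ _ _ _ _ _ _ _ x)).
- by move=> i; have [] := hb i.
- by move=> i; have [] := hb i.
- by move=> i; have [] := hb i.
- by move=> i; exact: flow_ge.
- by apply: thr => //; near: n.
- by near: n; exact: near_g_le.
- by move=> i; have /andP[h1 _] := HH n i; exact: flow_le.
- exact: amu.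
rewrite lee_fin mul1r -mulrA ler_wpM2l//.
by near: n; exact: near_tail_le_g.
Unshelve. all: by end_near. Qed.
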